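(* Let $X$ be a Tychonoff space. Every subset $A\subset X$ that is $r$-weakly compact-bounded in $X$ is strongly $r$-pseudocompact in $X$.
   Context: All spaces are assumed to be Tychonoff. Let $A$ be a subset of a space $X$. A family of open sets in $X$ ''meeting $A$'' is one each of whose members intersects $A$; an accumulation point of a family of sets is a point every neighborhood of which meets infinitely many members of the family. $A$ is $r$-pseudocompact in $X$ if every infinite family of open sets in $X$ meeting $A$ has an accumulation point in $A$. $A$ is strongly $r$-pseudocompact in $X$ if $A\times B$ is $r$-pseudocompact in $X\times Y$ whenever $B$ is an $r$-pseudocompact subset of a (Tychonoff) space $Y$. $A$ is $r$-weakly compact-bounded in $X$ if for every infinite family $\mathcal U$ of open sets in $X$ meeting $A$ there is a compact subset $K_A\subset A$ which intersects infinitely many elements of $\mathcal U$. *)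

(* Defs.v *)
From mathcomp Require Import all_boot all_order all_algebra.
From mathcomp Require Import all_classical all_reals all_analysis.

Set Implicit Arguments.
Unset Strict Implicit.
Unset Printing Implicit Defensive.

Local Open Scope classical_set_scope.

(* The library states complete regularity with [uniform_separator]; by
   [uniform_separatorP] this is separation of points from closed sets by a
   continuous function into the real interval [0, 1]. *)
Definition tychonoff_space (T : topologicalType) : Prop :=
  completely_regular_space T /\ hausdorff_space T.

(* Families of open sets are sets of sets, so an infinite family has infinitely
   many distinct members. *)
Definition open_family_meeting (X : topologicalType) (A : set X)
    (U : set (set X)) : Prop :=
  forall V, U V -> open V /\ V `&` A !=set0.

Definition accumulation_point (X : topologicalType) (U : set (set X))
    (x : X) : Prop :=
  forall N, nbhs x N -> infinite_set [set V | U V /\ N `&` V !=set0].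

Definition r_pseudocompact (X : topologicalType) (A : set X) : Prop :=
  forall U : set (set X), infinite_set U -> open_family_meeting A U ->
    exists2 x, A x & accumulation_point U x.

Definition strongly_r_pseudocompact (X : topologicalType) (A : set X) : Prop :=
  forall (Y : topologicalType) (B : set Y),
    tychonoff_space Y -> r_pseudocompact B ->
    r_pseudocompact (A `*` B).

Definition r_weakly_compact_bounded (X : topologicalType) (A : set X) : Prop :=
  forall U : set (set X), infinite_set U -> open_family_meeting A U ->
    exists K : set X,
      [/\ compact K, K `<=` A & infinite_set [set V | U V /\ K `&` V !=set0]].

(* Main.v *)
Require Import Defs.
From mathcomp Require Import all_boot all_order all_algebra.
From mathcomp Require Import all_classical all_reals all_analysis.

(** Shrink each member [W] of the family to an open box [P W `*` Q W] meeting
    [A `*` B].  Some compact [K `<=` A] meets [P W] for infinitely many [W], and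
    the sets [Q W] for these [W] accumulate at some [y] in [B].  Choosing
    [x W] in [K `&` P W], compactness of [K] gives a cluster point [x] of the
    points [x W] along the filter of sets containing all but finitely many of
    the [W] whose [Q W] meets a given neighbourhood of [y]; then [(x, y)] is an
    accumulation point of the family. *)

Local Open Scope classical_set_scope.

(** Pigeonhole: otherwise [D] would be a finite union of finite fibers. This is needed because
    families are sets of sets, so infinitely many indices may name only finitely many distinct
    members. *)
Lemma infinite_image_or_fiber {I T : Type} (f : I -> T) (D : set I) :
  infinite_set D -> infinite_set (f @` D) \/
  exists2 i, D i & infinite_set (D `&` f @^-1` [set f i]).
Proof.
move=> Dinf; have [fD|] := pselect (finite_set (f @` D)); last by left.
right; apply: contrapT => noi; apply: Dinf.
have -> : D = \bigcup_(t in f @` D) (D `&` f @^-1` [set t]).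
  apply/seteqP; split=> [i Di|i [t _ [//]]].
  by exists (f i) => //; exists i.
apply: bigcup_finite => // _ [i Di <-]; apply: contrapT => fib.
by apply: noi; exists i.
Qed.

Lemma infinite_indices {I T : Type} (f : I -> T) (D : set I) (R : set T) :
  infinite_set [set t | (f @` D) t /\ R t] ->
  infinite_set [set i | D i /\ R (f i)].
Proof.
move=> inf fin; apply: inf.
apply: sub_finite_set (finite_image f fin) => _ [[i Di <-] Ri].
by exists i.
Qed.

(** If the sets [Q i] take infinitely many values, the definition applies to their image. Otherwise
    one value recurs infinitely often, and any of its points in [B] works. *)
Lemma r_pseudocompact_indexed {Y : topologicalType} (B : set Y) {I : Type}
    (D : set I) (Q : I -> set Y) :
  r_pseudocompact B -> infinite_set D -> open_family_meeting B (Q @` D) ->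
  exists2 y, B y & forall N, nbhs y N ->
    infinite_set [set i | D i /\ N `&` Q i !=set0].
Proof.
move=> Bpc Dinf QB; have [Qinf|[i Di fib]] := infinite_image_or_fiber Q D Dinf.
  have [y By yacc] := Bpc _ Qinf QB; exists y => // N Ny.
  exact: infinite_indices (yacc N Ny).
have [|oQ [b [Qb Bb]]] := QB (Q i); first by exists i.
exists b => // N Nb; apply: contra_not fib; apply: sub_finite_set => j [Dj /= Qj].
by split=> //; exists b; split; [exact: nbhs_singleton|rewrite Qj].
Qed.

(** Same dichotomy; for a recurring value, a singleton serves as the compact set. *)
Lemma r_weakly_compact_bounded_indexed {X : topologicalType} (A : set X)
    {I : Type} (D : set I) (P : I -> set X) :
  r_weakly_compact_bounded A -> infinite_set D ->
  open_family_meeting A (P @` D) ->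
  exists K, [/\ compact K, K `<=` A &
    infinite_set [set i | D i /\ K `&` P i !=set0]].
Proof.
move=> Awcb Dinf PA; have [Pinf|[i Di fib]] := infinite_image_or_fiber P D Dinf.
  have [K [cK KA Kinf]] := Awcb _ Pinf PA; exists K; split=> //.
  exact: infinite_indices Kinf.
have [|oP [a [Pa Aa]]] := PA (P i); first by exists i.
exists [set a]; split; [exact: compact_set1|by move=> _ ->|].
apply: contra_not fib; apply: sub_finite_set => j [Dj /= Pj].
by split=> //; exists a; split; [|rewrite Pj].
Qed.

Lemma compact_accumulation_prod {X Y : topologicalType} (K : set X) {I : Type}
    (D : set I) (P : I -> set X) (Q : I -> set Y) (y : Y) :
  compact K -> (forall i, D i -> K `&` P i !=set0) ->
  (forall N, nbhs y N -> infinite_set [set i | D i /\ N `&` Q i !=set0]) ->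
  exists2 x, K x & forall N, nbhs (x, y) N ->
    infinite_set [set i | D i /\ N `&` (P i `*` Q i) !=set0].
Proof.
move=> cK KP yacc.
pose E M := [set i | D i /\ M `&` Q i !=set0].
have [i0 [Di0 _]] : E setT !=set0.
  by apply: infinite_setN0; apply: yacc; exact: filterT.
(* [x0] is only a default value for the choice function outside [D]. *)
have [x0 _] := KP i0 Di0.
have [x xP] : {x : I -> X & forall i, D i -> (K `&` P i) (x i)}.
  apply: (choice (P := fun i z => D i -> (K `&` P i) z)) => i.
  have [Di|nDi] := pselect (D i); last by exists x0.
  by have [z Kz] := KP i Di; exists z.
pose G : set_system I :=
  [set S | exists2 M, nbhs y M & finite_set (E M `\` S)].
have GF : ProperFilter G.
  (* A member [S] is nonempty: [E M] is infinite and only finitely many of its indices lie outside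
     [S]. *)
  apply: Build_ProperFilter_ex => [S [M yM fin]|].
    have [i [Ei nfin]] : (E M `\` (E M `\` S)) !=set0.
      by apply: infinite_setN0; apply: infinite_setD => //; exact: yacc.
    by exists i; apply: contrapT => nS; apply: nfin.
  split.
  - by exists setT; [exact: filterT|rewrite setDT].
  - move=> S1 S2 [M1 yM1 f1] [M2 yM2 f2]; exists (M1 `&` M2); first exact: filterI.
    apply: sub_finite_set (_ : finite_set ((E M1 `\` S1) `|` (E M2 `\` S2))).
      move=> i [[Di [z [[z1 z2] Qz]]] nS].
      have [S1i|nS1] := pselect (S1 i); [right|left].
        by split; [split=> //; exists z|move=> S2i; apply: nS].
      by split=> //; split=> //; exists z.
    by rewrite finite_setU.
  - move=> S1 S2 S12 [M yM f]; exists M => //.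
    by apply: sub_finite_set f => i [Ei nS]; split=> // /S12.
have GE M : nbhs y M -> G (E M).
  by move=> yM; exists M => //; rewrite setDv; exact: finite_set0.
have [|z [Kz zcl]] := cK (x @ G) _.
  apply: filterS (GE setT filterT) => i [Di _] /=.
  by have [] := xP i Di.
exists z => // N [[N1 N2] /= [zN1 yN2] sN] fin.
(* Were the good indices finite in number, removing them from [E N2] would leave a member of [G].
   Clustering at [z] then gives a remaining [i] with [x i] in [N1], and this [i] is good after
   all. *)
have GS : G (E N2 `\` [set i | D i /\ N `&` (P i `*` Q i) !=set0]).
  exists N2 => //; apply: sub_finite_set fin => i [Ei nE].
  by apply: contrapT => nfin; apply: nE.
have [_ [[i [[Di [w [N2w Qw]]] nfin] <-] N1x]] :
    (x @` (E N2 `\` [set i | D i /\ N `&` (P i `*` Q i) !=set0]) `&` N1) !=set0.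
  apply: zcl => //; apply: filterS GS => i Si /=; by exists i.
have [_ Px] := xP i Di.
by apply: nfin; split=> //; exists (x i, w); split; [exact: sN|].
Qed.

Lemma open_box_meeting {X Y : topologicalType} (A : set X) (B : set Y)
    (W : set (X * Y)) :
  open W -> W `&` (A `*` B) !=set0 ->
  exists PQ : set X * set Y,
    [/\ open PQ.1 /\ PQ.1 `&` A !=set0, open PQ.2 /\ PQ.2 `&` B !=set0 &
        PQ.1 `*` PQ.2 `<=` W].
Proof.
move=> oW [[a b] [Wab [/= Aa Bb]]].
have [[P Q] /= [aP bQ] PQW] : nbhs (a, b) W by exact: open_nbhs_nbhs.
exists (P^°, Q^°); split=> /=.
- by split; [exact: open_interior|exists a].
- by split; [exact: open_interior|exists b].
- by move=> [u v] [/= Pu Qv]; apply: PQW; split; exact: nbhs_singleton.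
Qed.

Theorem proposition6p3 (X : topologicalType) (A : set X) :
  tychonoff_space X -> r_weakly_compact_bounded A -> strongly_r_pseudocompact A.
Proof.
move=> _ Awcb Y B _ Bpc U Uinf UAB.
have [PQ PQP] : {PQ : set (X * Y) -> set X * set Y & forall W, U W ->
    [/\ open (PQ W).1 /\ (PQ W).1 `&` A !=set0,
        open (PQ W).2 /\ (PQ W).2 `&` B !=set0 &
        (PQ W).1 `*` (PQ W).2 `<=` W]}.
  apply: (choice (P := fun W (R : set X * set Y) => U W ->
    [/\ open R.1 /\ R.1 `&` A !=set0, open R.2 /\ R.2 `&` B !=set0 &
        R.1 `*` R.2 `<=` W])) => W.
  have [UW|nUW] := pselect (U W); last by exists (set0, set0).
  have [oW WAB] := UAB W UW.
  by have [R RP] := open_box_meeting A B W oW WAB; exists R.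
(* The members [W] of [U] are themselves the indices, so distinct members stay distinct even when
   their boxes coincide. *)
have [|K [cK KA Kinf]] :=
  r_weakly_compact_bounded_indexed A U (fun W => (PQ W).1) Awcb Uinf.
  by move=> _ [W UW <-]; have [] := PQP W UW.
have [|y By yacc] := r_pseudocompact_indexed B _ (fun W => (PQ W).2) Bpc Kinf.
  by move=> _ [W [UW _] <-]; have [] := PQP W UW.
have [|x Kx xyacc] :=
  compact_accumulation_prod K _ (fun W => (PQ W).1) _ y cK _ yacc.
  by move=> W [].
exists (x, y); first by split=> //; exact: KA.
move=> N /xyacc; apply: contra_not; apply: sub_finite_set.
move=> W [[UW _] [w [Nw PQw]]]; split=> //; exists w; split=> //.
by have [_ _] := PQP W UW; apply.
Qed.
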